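(* Let $D$ be a P$v$MD that is not a field. Then $D$ is a valuation domain if and only if $D$ contains a nonzero nonunit comparable element.
   Context: A nonzero element $c$ of an integral domain $D$ is comparable in $D$ if for every $x\in D$ one has $cD\subseteq xD$ or $xD\subseteq cD$. Let $K$ be the quotient field of $D$. For a nonzero fractional ideal $E$ of $D$ put $E^{-1}=\{x\in K: xE\subseteq D\}$, $E^v=(E^{-1})^{-1}$, and $E^t=\bigcup\{F^v : F\subseteq E,\ F \text{ a nonzero finitely generated ideal}\}$. $D$ is a Prüfer $v$-multiplication domain (P$v$MD) if $(FF^{-1})^t=D$ for every nonzero finitely generated fractional ideal $F$ of $D$. *)

(* Defs.v *)
From mathcomp Require Import all_boot all_order all_algebra.
From mathcomp Require Import boolp classical_sets.

Set Implicit Arguments.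
Unset Strict Implicit.
Unset Printing Implicit Defensive.

Import GRing.Theory.

Local Open Scope ring_scope.
Local Open Scope classical_set_scope.

Notation "x %:F" := (@FracField.tofrac _ x) : ring_scope.

(* D viewed inside its quotient field *)
Definition base (D : idomainType) : set {fraction D} :=
  range (@FracField.tofrac D).
Arguments base : clear implicits.

Section Ideals.
Variable D : idomainType.
Local Notation K := {fraction D}.

Definition principal (c : D) : set D := [set c * d | d in [set: D]].

Definition comparable_element (c : D) : Prop :=
  c != 0 /\
  forall x : D, principal c `<=` principal x \/ principal x `<=` principal c.

Definition submodule (E : set K) : Prop :=
  [/\ E 0,
      forall x y, E x -> E y -> E (x + y)
    & forall (d : D) x, E x -> E (d%:F * x)].

Definition fractional_ideal (E : set K) : Prop :=
  submodule E /\
  exists2 d : D, d != 0 & forall x, E x -> base D (d%:F * x).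

Definition nonzero (E : set K) : Prop := exists2 x, E x & x != 0.

Definition spanned n (g : 'I_n -> K) : set K :=
  [set x | exists a : 'I_n -> D, x = \sum_(i < n) (a i)%:F * g i].

Definition finitely_generated (E : set K) : Prop :=
  exists n (g : 'I_n -> K), E = spanned g.

Definition ideal_mul (E F : set K) : set K :=
  [set x | exists n (a b : 'I_n -> K),
    (forall i, E (a i) /\ F (b i)) /\ x = \sum_(i < n) a i * b i].

Definition ideal_inv (E : set K) : set K :=
  [set x | forall y, E y -> base D (x * y)].

Definition v_closure (E : set K) : set K := ideal_inv (ideal_inv E).

(* F ranges over fractional ideals, as E need not be contained in D; when E is
   contained in D, every such F is an integral ideal. *)
Definition t_closure (E : set K) : set K :=
  \bigcup_(F in [set F | [/\ fractional_ideal F, nonzero F,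
                             finitely_generated F & F `<=` E]]) v_closure F.

End Ideals.

Definition PvMD (D : idomainType) : Prop :=
  forall F : set {fraction D},
    fractional_ideal F -> nonzero F -> finitely_generated F ->
    t_closure (ideal_mul F (ideal_inv F)) = base D.

Definition valuation_domain (D : idomainType) : Prop :=
  forall x : {fraction D}, x != 0 -> base D x \/ base D x^-1.

(* Main.v *)
Require Import Defs.
From mathcomp Require Import all_boot all_order all_algebra.
From mathcomp Require Import boolp classical_sets.

Set Implicit Arguments.
Unset Strict Implicit.
Unset Printing Implicit Defensive.

Import GRing.Theory.
Local Open Scope ring_scope.

(** Over a domain with a nonzero nonunit comparable element [c], nonunits are
    very far from generating the unit ideal.  A divisor [x] of a comparable
    element [x * y] is comparable, because comparing [x] with [z] amounts to
    comparing [x * y] with [z * y]; hence, starting from [c] and passing to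
    [y] whenever a nonunit [y] fails to be a multiple of the current element,
    any finite family of nonunits acquires a common divisor that is itself a
    nonunit ([nonunits_common_divisor]).  Two consequences follow.  Sums of
    nonunits are nonunits, so the domain is local.  And a finitely generated
    ideal contained in the maximal ideal lies in a proper principal ideal, so
    its v-closure is proper too ([v_closure_unit_generator]): the maximal ideal
    is a t-ideal.

    Over a PvMD this removes the t from t-invertibility.  For [x] in the
    quotient field and [F = (1, x)], the ideal [F F^-1] has t-closure [D], so it
    cannot lie in the maximal ideal; by locality it contains a unit of the form
    [y] or [x * y] with [y] in [F^-1], that is, with [y] and [x * y] in [D].
    In the first case [x = (x * y) / y] is in [D], in the second
    [x^-1 = y / (x * y)] is.

    Conversely, in a valuation domain every nonzero element is comparable, and
    outside the case of a field one of them is a nonunit. *)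

Section Comparable.
Variable D : idomainType.
Implicit Types (c x y : D) (s : seq D).

(** Membership [principal x y] of [y] in [xD] serves throughout as the relation
    [x] divides [y]. *)
Lemma principal_trans x y z :
  principal x y -> principal y z -> principal x z.
Proof. by move=> [d _ <-] [e _ <-]; exists (d * e); rewrite ?mulrA. Qed.

Lemma principal_refl x : principal x x.
Proof. by exists 1; rewrite ?mulr1. Qed.

Lemma comparable_elementP c :
  comparable_element c <->
  c != 0 /\ forall x, principal x c \/ principal c x.
Proof.
split=> -[c0 cmp]; split=> // x; case: (cmp x) => h.
- by left; apply: h; apply: principal_refl.
- by right; apply: h; apply: principal_refl.
- by left=> y; apply: principal_trans.
- by right=> y; apply: principal_trans.
Qed.

(** Multiplying by the cofactor [y] turns a comparison with [x] into a
    comparison with [x * y], and [y] then cancels. *)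
Lemma comparable_divisor c x :
  comparable_element c -> principal x c -> comparable_element x.
Proof.
move=> /comparable_elementP[c0 cmp] [y _ def_c]; apply/comparable_elementP.
move: c0; rewrite -def_c mulf_eq0 negb_or => /andP[x0 y0]; split=> // z.
case: (cmp (z * y)); rewrite -def_c => -[d _ e]; [left | right];
  by exists d => //; apply: (mulIf y0); rewrite mulrAC e.
Qed.

(** The induction on [s] runs over all comparable nonunits [c], so that [c] can
    be exchanged for one of its divisors. *)
Lemma nonunits_common_divisor c s :
    comparable_element c -> c \isn't a GRing.unit ->
    {in s, forall y, y \isn't a GRing.unit} ->
  exists x, [/\ x \isn't a GRing.unit, principal x c
              & forall y, y \in s -> principal x y].
Proof.
elim: s c => [|y s IHs] c cmp_c cU sU.
  by exists c; split=> //; apply: principal_refl.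
have sU' : {in s, forall z, z \isn't a GRing.unit}.
  by move=> z zs; apply: sU; rewrite inE zs orbT.
have [_ /(_ y)[y_c | c_y]] := (comparable_elementP c).1 cmp_c.
- have yU : y \isn't a GRing.unit by apply: sU; rewrite mem_head.
  have [x [xU x_y xs]] := IHs y (comparable_divisor cmp_c y_c) yU sU'.
  exists x; split=> // [|z]; first exact: principal_trans x_y y_c.
  by rewrite inE => /predU1P[->|/xs].
- have [x [xU x_c xs]] := IHs c cmp_c cU sU'.
  exists x; split=> // z; rewrite inE => /predU1P[->|/xs //].
  exact: principal_trans x_c c_y.
Qed.

(** Locality: a common nonunit divisor of two nonunits also divides their sum,
    so a sum of nonunits is never a unit. *)
Lemma unit_sum_unit_term c n (f : 'I_n -> D) :
    comparable_element c -> c \isn't a GRing.unit ->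
    \sum_i f i \is a GRing.unit ->
  exists i, f i \is a GRing.unit.
Proof.
move=> cmp_c cU sumU; apply: contrapT => no_unit; move: sumU; apply/negP.
apply: (big_ind (fun x => x \isn't a GRing.unit)) => [|x y xU yU|i _].
- by rewrite unitr0.
- have xyU : {in [:: x; y], forall z, z \isn't a GRing.unit}.
    by move=> z; rewrite !inE => /orP[] /eqP->.
  have [b [bU _ b_xy]] := nonunits_common_divisor cmp_c cU xyU.
  have [d _ <-] := b_xy x (mem_head _ _).
  have [e _ <-] := b_xy y (mem_last x [:: y]).
  by rewrite -mulrDr unitrM (negPf bU).
- by apply/negP => fiU; apply: no_unit; exists i.
Qed.

End Comparable.

Section QuotientField.
Variable D : idomainType.
Local Notation K := {fraction D}.

Lemma fraction_denominator (x : K) : exists2 d : D, d != 0 & base D (d%:F * x).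
Proof.
elim/quotW: x => r.
exists \d_r; first exact: denom_ratioP.
exists \n_r => //; symmetry; rewrite /GRing.mul /= !piE.
apply/eqmodP; rewrite /= FracField.equivfE.
by rewrite !numden_Ratio ?(oner_eq0, mul1r, mulr1, denom_ratioP) // mulrC.
Qed.

Lemma base_unit (d : D) : d != 0 -> base D (d%:F)^-1 -> d \is a GRing.unit.
Proof.
move=> d0 [e _ e_inv]; apply/unitrPr; exists e.
by apply/eqP; rewrite -tofrac_eq tofracM e_inv tofrac1 mulfV // tofrac_eq0.
Qed.

Lemma base_div (d : D) (x : K) :
  d \is a GRing.unit -> base D (d%:F * x) -> base D x.
Proof.
move=> dU [e _ def_e]; exists (d^-1 * e) => //.
by rewrite tofracM def_e mulrA -tofracM mulVr // tofrac1 mul1r.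
Qed.

Lemma base_sum n (f : 'I_n -> K) :
  (forall i, base D (f i)) -> base D (\sum_i f i).
Proof.
move=> fD; apply: (big_ind (base D)) => [|_ _ [a _ <-] [b _ <-]|//].
- by exists 0; rewrite ?tofrac0.
- by exists (a + b); rewrite ?tofracD.
Qed.

Lemma spanned_gen n (g : 'I_n -> K) i : spanned g (g i).
Proof.
exists (fun j => (j == i)%:R); rewrite (bigD1 i) //= eqxx tofrac1 mul1r.
rewrite big1 ?addr0 // => j /negPf->.
by rewrite tofrac0 mul0r.
Qed.

Lemma spanned_submodule n (g : 'I_n -> K) : submodule (spanned g).
Proof.
split.
- by exists (fun=> 0); rewrite big1 // => i _; rewrite tofrac0 mul0r.
- move=> _ _ [a ->] [b ->]; exists (fun i => a i + b i).
  by rewrite -big_split; apply: eq_bigr => i _; rewrite tofracD mulrDl.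
- move=> d _ [a ->]; exists (fun i => d * a i).
  by rewrite mulr_sumr; apply: eq_bigr => i _; rewrite tofracM mulrA.
Qed.

(** If no generator were a unit, their common nonunit divisor [x] would put
    [x^-1] into the inverse of the ideal they generate, so that [1] in the
    v-closure would force [x^-1] into [D]. *)
Lemma v_closure_unit_generator (c : D) n (h : 'I_n -> D) :
    comparable_element c -> c \isn't a GRing.unit ->
    v_closure (spanned (fun i => (h i)%:F)) 1 ->
  exists i, h i \is a GRing.unit.
Proof.
move=> cmp_c cU v1; apply: contrapT => no_unit.
have hU : {in codom h, forall y, y \isn't a GRing.unit}.
  by move=> _ /codomP[i ->]; apply/negP => hiU; apply: no_unit; exists i.
have [x [xU x_c x_h]] := nonunits_common_divisor cmp_c cU hU.
have x0 : x != 0.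
  case: cmp_c x_c => c0 _ [y _ def_c].
  by apply: contraNneq c0 => x0; rewrite -def_c x0 mul0r.
case/negP: xU; apply: base_unit => //; rewrite -[_^-1]mul1r; apply: v1.
move=> _ [a ->]; rewrite mulr_sumr; apply: base_sum => i.
have [d _ <-] := x_h (h i) (codom_f h i).
exists (a i * d) => //; rewrite !tofracM mulrCA; congr (_ * _).
by rewrite mulKf // tofrac_eq0.
Qed.

End QuotientField.

Theorem corollary4p11 (D : idomainType) (hD : PvMD D)
    (hnf : ~ GRing.field_axiom D) :
  valuation_domain D <->
  exists c : D, [/\ c != 0, c \isn't a GRing.unit & comparable_element c].
Proof.
split=> [valD | [c [_ cU cmp_c]] x x0].
  have [c] : exists c : D, ~ (c != 0 -> c \is a GRing.unit).
    apply: contrapT => allU; apply: hnf => c; apply: contrapT => cU.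
    by apply: allU; exists c.
  move=> /not_implyP[c0 /negP cU]; exists c; split=> //.
  apply/comparable_elementP; split=> // x.
  have [-> | x0] := eqVneq x 0; first by right; exists 0; rewrite ?mulr0.
  have cF0 : c%:F != 0 by rewrite tofrac_eq0.
  have xF0 : x%:F != 0 by rewrite tofrac_eq0.
  have [|[d _ e]|[d _ e]] := valD (c%:F / x%:F).
  - by rewrite mulf_neq0 ?invr_eq0.
  - left; exists d => //; apply/eqP.
    by rewrite -tofrac_eq tofracM e mulrC divfK.
  - right; exists d => //; apply/eqP.
    by rewrite -tofrac_eq tofracM e invf_div mulrC divfK.
(* [g] generates the fractional ideal [F = (1, x)]. *)
pose g (i : 'I_2) : {fraction D} := if i == ord0 then 1 else x.
have fracF : fractional_ideal (spanned g).
  split; first exact: spanned_submodule.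
  have [d d0 dx] := fraction_denominator x; exists d => // _ [a ->].
  rewrite mulr_sumr; apply: base_sum => i; rewrite mulrCA.
  have [e _ <-] : base D (d%:F * g i).
    by rewrite /g; case: ifP => // _; rewrite mulr1; exists d.
  by exists (a i * e); rewrite ?tofracM.
have nzF : nonzero (spanned g).
  by exists x => //; apply: (spanned_gen g ord_max).
have [G [_ _ [n [h ->]] GFF] vG] :
    t_closure (ideal_mul (spanned g) (ideal_inv (spanned g))) 1.
  by rewrite hD //; [exists 1; rewrite ?tofrac1 | exists 2, g].
have mulD a b : spanned g a -> ideal_inv (spanned g) b -> base D (a * b).
  by move=> Fa Fb; rewrite mulrC; apply: Fb.
(* Since [F F^-1] lies in [D], the generators [h] come from elements of [D]. *)
have /fin_all_exists[k def_h] i : exists d : D, d%:F = h i.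
  have [m [a [b [ab ->]]]] := GFF _ (spanned_gen h i).
  have [d _ <-] : base D (\sum_j a j * b j).
    by apply: base_sum => j; have [] := ab j; apply: mulD.
  by exists d.
have [i kiU] : exists i, k i \is a GRing.unit.
  apply: (v_closure_unit_generator cmp_c cU).
  by rewrite (_ : (fun i => (k i)%:F) = h) //; apply/funext.
have [m [a [b [ab def_hi]]]] := GFF _ (spanned_gen h i).
have /fin_all_exists[t def_t] j : exists d : D, d%:F = a j * b j.
  by have [Fa Fb] := ab j; have [d _ <-] := mulD _ _ Fa Fb; exists d.
have [j tjU] : exists j, t j \is a GRing.unit.
  apply: (unit_sum_unit_term cmp_c cU); congr (_ \is a GRing.unit): kiU.
  apply/eqP; rewrite -tofrac_eq def_h def_hi rmorph_sum; apply/eqP.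
  by apply: eq_bigr => j _; apply/esym/def_t.
have [[r def_aj] Fb] := ab j.
have [y _ def_y] : base D (b j).
  by rewrite -[b j]mulr1; apply/Fb/(spanned_gen g ord0).
have [z _ def_z] : base D (b j * x) by apply/Fb/(spanned_gen g ord_max).
(* With [a j = r 0 + r 1 * x], the unit [t j = a j * b j] is
   [r 0 * y + r 1 * z], and locality applies a second time. *)
have [l] : exists l : 'I_2, r l * (if l == ord0 then y else z) \is a GRing.unit.
  apply: (unit_sum_unit_term cmp_c cU); congr (_ \is a GRing.unit): tjU.
  apply/eqP; rewrite -tofrac_eq def_t def_aj mulr_suml rmorph_sum; apply/eqP.
  apply: eq_bigr => l _ /=; rewrite /g tofracM -mulrA; congr (_ * _).
  by case: ifP => _; rewrite ?mul1r ?def_y // def_z mulrC.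
rewrite unitrM => /andP[_]; case: ifP => _ => [yU | zU].
- left; apply: (base_div yU).
  by rewrite def_y; exists z.
- right; apply: (base_div zU).
  by rewrite def_z mulfK //; exists y.
Qed.
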